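(* The composite SBM score $\gamma:\mathbb{R}_{>0}^{m+s}\to\mathbb{R}$, defined by $\gamma(\mathbf{x},\mathbf{y})=\delta^*(\mathbf{x},\mathbf{y})\cdot\max\rho^*|_{\bar P}$ with $\bar P=\bar P(\mathbf{x},\mathbf{y})=\{(\bar{\mathbf{x}},\bar{\mathbf{y}})\in P\mid \bar{\mathbf{x}}\ge\mathbf{x},\ \bar{\mathbf{y}}\le\mathbf{y}\}$, is continuous.
   Context: Vector inequalities are componentwise; $\mathbb{R}_+=[0,\infty)$, $\mathbb{R}_{>0}=(0,\infty)$. An activity with $m$ inputs and $s$ outputs ($m,s\ge1$) is a pair $(\mathbf{x},\mathbf{y})\in\mathbb{R}_{>0}^{m+s}$ with $\mathbf{x}\in\mathbb{R}_{>0}^m$, $\mathbf{y}\in\mathbb{R}_{>0}^s$. Fix a set $\mathcal{D}$ of $n\ge 1$ reference DMUs, each identified with an activity $(\mathbf{x}_j,\mathbf{y}_j)\in\mathbb{R}_{>0}^{m+s}$, $j=1,\dots,n$; $X$ is the $m\times n$ matrix with columns $\mathbf{x}_j$ and $Y$ the $s\times n$ matrix with columns $\mathbf{y}_j$. The production possibility set is $P=\{(\mathbf{x},\mathbf{y})\in\mathbb{R}_{>0}^{m+s}\mid \mathbf{x}\ge X\boldsymbol{\lambda},\ \mathbf{y}\le Y\boldsymbol{\lambda}\text{ for some }\boldsymbol{\lambda}\in\mathbb{R}_+^n\}$. SBM efficiency score: for $(\mathbf{x},\mathbf{y})\in P$, $\rho^*(\mathbf{x},\mathbf{y})$ is the minimum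 of $$\rho(\mathbf{x},\mathbf{y},\mathbf{s}^-,\mathbf{s}^+)=\frac{1-\frac1m\sum_{i=1}^m s_i^-/x_i}{1+\frac1s\sum_{r=1}^s s_r^+/y_r}$$ over $\boldsymbol{\lambda}\in\mathbb{R}_+^n$, $\mathbf{s}^-\in\mathbb{R}_+^m$, $\mathbf{s}^+\in\mathbb{R}_+^s$ subject to $\mathbf{x}=X\boldsymbol{\lambda}+\mathbf{s}^-$, $\mathbf{y}=Y\boldsymbol{\lambda}-\mathbf{s}^+$; for $(\mathbf{x},\mathbf{y})\notin P$, $\rho^*(\mathbf{x},\mathbf{y})=1$. SBM super-efficiency score: for every activity, $\delta^*(\mathbf{x},\mathbf{y})$ is the minimum of $$\delta(\mathbf{x},\mathbf{y},\mathbf{t}^-,\mathbf{t}^+)=\frac{1+\frac1m\sum_{i=1}^m t_i^-/x_i}{1-\frac1s\sum_{r=1}^s t_r^+/y_r}$$ over $\boldsymbol{\lambda}\in\mathbb{R}_+^n$, $\mathbf{t}^-\in\mathbb{R}_+^m$, $\mathbf{t}^+\in\mathbb{R}_+^s$ subject to $\mathbf{x}+\mathbf{t}^-\ge X\boldsymbol{\lambda}$, $\mathbf{0}<\mathbf{y}-\mathbf{t}^+\le Y\boldsymbol{\lambda}$. $\max\rho^*|_{\bar P}$ denotes the maximum of $\rho^*$ over $\bar P$. *)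

(* Defs.v *)
From HB Require Import structures.
From mathcomp Require Import all_boot all_order all_algebra.
From mathcomp Require Import all_classical all_reals all_analysis.

Set Implicit Arguments.
Unset Strict Implicit.
Unset Printing Implicit Defensive.

Import Order.TTheory GRing.Theory Num.Theory.
Import numFieldNormedType.Exports.

Local Open Scope classical_set_scope.
Local Open Scope ring_scope.

Definition vec_le {R : realType} {k : nat} (u v : 'cV[R]_k) : Prop :=
  forall i : 'I_k, u i 0 <= v i 0.

Definition vec_lt {R : realType} {k : nat} (u v : 'cV[R]_k) : Prop :=
  forall i : 'I_k, u i 0 < v i 0.

(* The attained extremum, not inf/sup: [A `&` lbound A] has at most one
   element, and the default 0 is used only if [A] has no least element. *)
Definition set_min {R : realType} (A : set R) : R := xget 0 (A `&` lbound A).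

Definition set_max {R : realType} (A : set R) : R := xget 0 (A `&` ubound A).

Lemma set_minE (R : realType) (A : set R) (v : R) :
  A v -> lbound A v -> set_min A = v.
Proof.
move=> Av lAv; apply: xget_unique; first by split.
by move=> w [Aw lAw]; apply/eqP; rewrite eq_le lAw// lAv.
Qed.

Lemma set_maxE (R : realType) (A : set R) (v : R) :
  A v -> ubound A v -> set_max A = v.
Proof.
move=> Av uAv; apply: xget_unique; first by split.
by move=> w [Aw uAw]; apply/eqP; rewrite eq_le uAv// uAw.
Qed.

Definition activity {R : realType} {m s : nat} : set ('cV[R]_m * 'cV[R]_s) :=
  [set a | vec_lt 0 a.1 /\ vec_lt 0 a.2].

(* The columns of [X] and [Y] are the inputs and outputs of the reference
   DMUs. *)
Definition production_set {R : realType} {m s n : nat}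
    (X : 'M[R]_(m, n)) (Y : 'M[R]_(s, n)) : set ('cV[R]_m * 'cV[R]_s) :=
  [set a | activity a /\
     exists lam : 'cV[R]_n,
       [/\ vec_le 0 lam, vec_le (X *m lam) a.1 & vec_le a.2 (Y *m lam)]].

Definition sbm_rho {R : realType} {m s : nat} (a : 'cV[R]_m * 'cV[R]_s)
    (sl : 'cV[R]_m * 'cV[R]_s) : R :=
  (1 - m%:R^-1 * \sum_(i < m) sl.1 i 0 / a.1 i 0) /
  (1 + s%:R^-1 * \sum_(r < s) sl.2 r 0 / a.2 r 0).

Definition sbm_feasible {R : realType} {m s n : nat}
    (X : 'M[R]_(m, n)) (Y : 'M[R]_(s, n)) (a : 'cV[R]_m * 'cV[R]_s) :
    set ('cV[R]_m * 'cV[R]_s) :=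
  [set sl | exists lam : 'cV[R]_n,
     [/\ vec_le 0 lam, vec_le 0 sl.1, vec_le 0 sl.2,
         a.1 = X *m lam + sl.1 & a.2 = Y *m lam - sl.2]].

Definition sbm_score {R : realType} {m s n : nat}
    (X : 'M[R]_(m, n)) (Y : 'M[R]_(s, n)) (a : 'cV[R]_m * 'cV[R]_s) : R :=
  if a \in production_set X Y
  then set_min [set sbm_rho a sl | sl in sbm_feasible X Y a]
  else 1.

Definition super_sbm_delta {R : realType} {m s : nat}
    (a : 'cV[R]_m * 'cV[R]_s) (t : 'cV[R]_m * 'cV[R]_s) : R :=
  (1 + m%:R^-1 * \sum_(i < m) t.1 i 0 / a.1 i 0) /
  (1 - s%:R^-1 * \sum_(r < s) t.2 r 0 / a.2 r 0).

Definition super_sbm_feasible {R : realType} {m s n : nat}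
    (X : 'M[R]_(m, n)) (Y : 'M[R]_(s, n)) (a : 'cV[R]_m * 'cV[R]_s) :
    set ('cV[R]_m * 'cV[R]_s) :=
  [set t | [/\ vec_le 0 t.1, vec_le 0 t.2, vec_lt 0 (a.2 - t.2) &
     exists lam : 'cV[R]_n,
       [/\ vec_le 0 lam, vec_le (X *m lam) (a.1 + t.1) &
           vec_le (a.2 - t.2) (Y *m lam)]]].

Definition super_sbm_score {R : realType} {m s n : nat}
    (X : 'M[R]_(m, n)) (Y : 'M[R]_(s, n)) (a : 'cV[R]_m * 'cV[R]_s) : R :=
  set_min [set super_sbm_delta a t | t in super_sbm_feasible X Y a].

Definition dominated_set {R : realType} {m s n : nat}
    (X : 'M[R]_(m, n)) (Y : 'M[R]_(s, n)) (a : 'cV[R]_m * 'cV[R]_s) :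
    set ('cV[R]_m * 'cV[R]_s) :=
  [set b | [/\ production_set X Y b, vec_le a.1 b.1 & vec_le b.2 a.2]].

Definition composite_sbm_score {R : realType} {m s n : nat}
    (X : 'M[R]_(m, n)) (Y : 'M[R]_(s, n)) (a : 'cV[R]_m * 'cV[R]_s) : R :=
  super_sbm_score X Y a *
  set_max [set sbm_score X Y b | b in dominated_set X Y a].

(* Main.v *)
Require Import Defs.
From mathcomp Require Import all_boot all_order all_algebra.
From mathcomp Require Import all_classical all_reals all_analysis.
From mathcomp Require Import ring lra.
Set Implicit Arguments.
Unset Strict Implicit.
Unset Printing Implicit Defensive.
Import Order.TTheory GRing.Theory Num.Theory.
Import numFieldNormedType.Exports.
Local Open Scope classical_set_scope.
Local Open Scope ring_scope.

(** Both factors of the composite score are extrema over the same set of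
    activities of [P] dominated by [(x, y)]: the super-efficiency score is the
    minimum of [Q b a = mean (b.1 / a.1) / mean (b.2 / a.2)] over dominated
    [b], and the other factor is the maximum of the SBM score, which is itself
    the minimum of [Q (X lam, Y lam) b] over the [lam >= 0] feasible for [b].

    Everything is measured multiplicatively.  Write [dominates t p q] when the
    inputs of [p] are at most [t] times those of [q] and the outputs of [q] at
    most [t] times those of [p].  If [a] and [a'] dominate each other up to a
    factor [t], an activity [b] dominated by [a] becomes one dominated by [a']
    when its inputs are multiplied and its outputs divided by [t]
    ([inflate_dominated]), at the price of a factor [t] in the domination.
    Hence an extremum over dominated activities changes by at most a power of
    [t] as soon as its objective does, and a nonnegative function with that
    property is continuous ([log_lipschitz_continuous]).

    For [Q] the required estimate is immediate ([ratio_quotient_scale]).  For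
    the SBM score it is the heart of the proof, and the only place where the
    polyhedral shape of [P] matters: when [b] dominates [b'] up to a factor
    [t], an optimal [lam] for [b] must be corrected into a feasible one for
    [b'] at a cost proportional to [t - 1], uniformly up to the boundary of
    [P].  This is Hoffman's error bound for systems of linear inequalities
    ([hoffman]), proved by Fourier-Motzkin elimination, and [feasible_stable]
    is its application.

    The extrema are attained because rescaling [lam] moves any dominated
    activity to a better one inside a fixed compact box
    ([dominated_set_box]). *)

(** * Hoffman error bound *)

(** Here [U i] for [P i] are upper bounds and [U j] for [Q j] lower bounds on an
    unknown: a value violating each of them by at most [e] can be moved by
    [e] to satisfy all of them. *)
Lemma clamp_between (R : realDomainType) (I : finType) (P Q : pred I)
    (U : I -> R) (z e : R) : 0 <= e ->
  (forall i j, P i -> Q j -> U j <= U i) ->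
  (forall i, P i -> z <= U i + e) -> (forall j, Q j -> U j <= z + e) ->
  exists z', [/\ `|z' - z| <= e, forall i, P i -> z' <= U i &
                 forall j, Q j -> U j <= z'].
Proof.
move=> e0 UU zU Uz; exists (\big[Num.max/z - e]_(j | Q j) U j); split.
- rewrite ler_distl bigmax_ge_id /=; apply: bigmax_le => //; lra.
- by move=> i Pi; apply: bigmax_le => [|j /(UU _ _ Pi)//]; rewrite lerBlDr zU.
- by move=> j Qj; apply: le_bigmax_cond.
Qed.

Lemma ler_norm_sumM (R : realDomainType) n (a x y : nat -> R) (d : R) :
  (forall j, (j < n)%N -> `|x j - y j| <= d) ->
  `|\sum_(j < n) a j * x j - \sum_(j < n) a j * y j| <=
    (\sum_(j < n) `|a j|) * d.
Proof.
move=> xy; rewrite -sumrB mulr_suml; apply: le_trans (ler_norm_sum _ _ _) _.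
apply: ler_sum => j _.
by rewrite -mulrBr normrM ler_wpM2l// xy.
Qed.

Lemma ler_term_sum (R : numDomainType) (I : finType) (F : I -> R) i :
  (forall j, 0 <= F j) -> F i <= \sum_j F j.
Proof. by move=> F0; rewrite (bigD1 i)//= lerDl sumr_ge0. Qed.

(** Induction on the number of variables: Fourier-Motzkin elimination of the
    last one multiplies violations by a constant, the smaller system is
    corrected by induction, and the last variable is then clamped between the
    bounds that the corrected variables impose on it.  The constant depends on
    the rows only, so it survives arbitrary changes of the right-hand side.
    Vectors are functions on [nat], of which only the first [n] values
    matter, so that a prefix needs no cast. *)
Lemma hoffman (R : realFieldType) (n : nat) (I : finType) (A : I -> nat -> R) :
  exists2 K : R, 0 <= K &
  forall (b : I -> R) (v : R) (x : nat -> R), 0 <= v ->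
    (exists x0 : nat -> R, forall i, \sum_(j < n) A i j * x0 j <= b i) ->
    (forall i, \sum_(j < n) A i j * x j <= b i + v) ->
  exists x' : nat -> R, (forall i, \sum_(j < n) A i j * x' j <= b i) /\
    forall j, (j < n)%N -> `|x' j - x j| <= K * v.
Proof.
elim: n I A => [|n IH] I A.
  exists 0 => // b v x v0 [x0 x0P] _; exists x; split=> // i.
  by have := x0P i; rewrite !big_ord0.
(* The eliminated system keeps each row that does not involve the last
   variable, and has one row for each pair of an upper and a lower bound on
   it; all other indices carry the trivial row 0 <= 0. *)
pose a i := A i n.
pose rest i (x : nat -> R) := \sum_(j < n) A i j * x j.
pose bd (b : I -> R) (x : nat -> R) i := (b i - rest i x) / a i.
pose pr (p : I * I) := (0 < a p.1) && (a p.2 < 0).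
pose A' (k : I + I * I) (j : nat) := match k with
  | inl i => if a i == 0 then A i j else 0
  | inr p => if pr p then A p.1 j / a p.1 - A p.2 j / a p.2 else 0
  end.
pose b' (b : I -> R) (k : I + I * I) := match k with
  | inl i => if a i == 0 then b i else 0
  | inr p => if pr p then b p.1 / a p.1 - b p.2 / a p.2 else 0
  end.
have rowE i (x : nat -> R) :
    \sum_(j < n.+1) A i j * x j = rest i x + a i * x n.
  by rewrite big_ord_recr.
have A'l i (x : nat -> R) : \sum_(j < n) A' (inl i) j * x j
    = if a i == 0 then rest i x else 0.
  by rewrite /A'; case: ifP => // _; rewrite big1// => j _; rewrite mul0r.
have A'r p (x : nat -> R) b : b' b (inr p) - \sum_(j < n) A' (inr p) j * x j
    = if pr p then bd b x p.1 - bd b x p.2 else 0.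
  rewrite /A' /b'; case: ifP => _; last first.
    by rewrite big1 ?subr0// => j _; rewrite mul0r.
  have -> : \sum_(j < n) (A p.1 j / a p.1 - A p.2 j / a p.2) * x j =
      rest p.1 x / a p.1 - rest p.2 x / a p.2.
    rewrite /rest !mulr_suml -sumrB; apply: eq_bigr => j _; ring.
  rewrite /bd; ring.
(* Solved for the last variable [t], row [i] is an upper or a lower bound
   according to the sign of [a i]. *)
have bdP b (x : nat -> R) i t v : a i != 0 ->
    (rest i x + a i * t <= b i + v) =
    (if 0 < a i then t <= bd b x i + `|a i|^-1 * v
     else bd b x i - `|a i|^-1 * v <= t).
  move=> ai0; rewrite /bd.
  have -> : `|a i|^-1 * v = v * `|a i|^-1 by rewrite mulrC.
  case: ltrP => ai.
    by rewrite gtr0_norm// -mulrDl ler_pdivlMr// -lerBrDl mulrC addrAC.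
  have {}ai : a i < 0 by rewrite lt_neqAle ai0.
  rewrite ltr0_norm// invrN mulrN opprK -mulrDl ler_ndivrMr//.
  by rewrite -lerBrDl mulrC addrAC.
pose g i := `|a i|^-1.
have g0 i : 0 <= g i by rewrite invr_ge0.
pose c := 1 + (\sum_i g i) *+ 2.
have c1 : 1 <= c by rewrite lerDl mulrn_wge0// sumr_ge0.
have c0 : 0 <= c by apply: le_trans c1.
have gc i j : g i + g j <= c.
  by rewrite /c mulr2n ler_wpDl// lerD// ler_term_sum.
have [K K0 KP] := IH _ A'.
pose N i : R := \sum_(j < n) `|A i j|.
have N0 i : 0 <= N i by apply: sumr_ge0.
(* [K * c * v] bounds the correction of the first variables, so [E * v]
   dominates the violation of each bound on the last one after it. *)
pose E : R := \sum_i g i * (1 + N i * (K * c)).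
have Kc0 : 0 <= K * c by rewrite mulr_ge0.
have T0 i : 0 <= g i * (1 + N i * (K * c)).
  by rewrite mulr_ge0// addr_ge0// mulr_ge0.
have E0 : 0 <= E by apply: sumr_ge0.
exists (K * c + E); first by rewrite addr_ge0.
move=> b v x v0 [x0 x0P] xP.
have [||| x' [x'P x'x]] := KP (b' b) (c * v) x.
- by rewrite mulr_ge0.
- have x0P' i : rest i x0 + a i * x0 n <= b i + 0 by rewrite addr0 -rowE.
  exists x0 => -[i|p]; rewrite -subr_ge0 ?A'r ?A'l /=.
    case: eqP => [ai|_]; last by rewrite subrr.
    by have := x0P' i; rewrite ai mul0r !addr0 subr_ge0.
  case: ifP => // /andP[p1 p2]; rewrite subr_ge0.
  have := x0P' p.1; rewrite bdP ?gt_eqF// p1 mulr0 addr0; apply: le_trans.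
  have := x0P' p.2; rewrite bdP ?lt_eqF// ltNge ltW//= mulr0 subr0; exact.
- have {}xP i : rest i x + a i * x n <= b i + v by rewrite -rowE.
  move=> [i|p]; rewrite -subr_ge0 addrAC ?A'r ?A'l /=.
    case: eqP => [ai|_]; last by rewrite subr0 add0r mulr_ge0.
    have := xP i; rewrite ai mul0r addr0 addrAC subr_ge0 => /le_trans; apply.
    by rewrite lerD2l ler_peMl.
  case: ifP => [/andP[p1 p2]|_]; last by rewrite add0r mulr_ge0.
  have := xP p.1; rewrite bdP ?gt_eqF// p1 -/(g _) => h1.
  have := xP p.2; rewrite bdP ?lt_eqF// ltNge ltW//= -/(g _) => h2.
  have : (g p.1 + g p.2) * v <= c * v by rewrite ler_wpM2r.
  lra.
have {}xP i : rest i x + a i * x n <= b i + v by rewrite -rowE.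
have bd_lip i : `|bd b x' i - bd b x i| <= g i * (N i * (K * c)) * v.
  rewrite /bd -mulrBl.
  have -> : b i - rest i x' - (b i - rest i x) = rest i x - rest i x' by ring.
  rewrite normrM normfV mulrC -[leRHS]mulrA -/(g i) ler_wpM2l//.
  rewrite distrC -mulrA; apply: ler_norm_sumM => j jn.
  by rewrite -mulrA; exact: x'x.
have gE i : g i * v + g i * (N i * (K * c)) * v <= E * v.
  rewrite -mulrDl ler_wpM2r// -{1}[g i]mulr1 -mulrDr.
  exact: (@ler_term_sum _ _ (fun i => g i * (1 + N i * (K * c)))).
have [| | | | z [zx zup zlo]] := @clamp_between _ _ (fun i => 0 < a i)
    (fun i => a i < 0) (bd b x') (x n) (E * v).
- by rewrite mulr_ge0.
- move=> i j ai aj; have := x'P (inr (i, j)).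
  by rewrite -subr_ge0 A'r /pr /= ai aj /= subr_ge0.
- move=> i ai; have := xP i; rewrite bdP ?gt_eqF// ai -/(g i).
  have := gE i; have := bd_lip i; rewrite ler_distl; lra.
- move=> i ai; have := xP i; rewrite bdP ?lt_eqF// ltNge ltW//= -/(g i).
  have := gE i; have := bd_lip i; rewrite ler_distl; lra.
exists (fun j => if j == n then z else x' j); split => [i|j].
  rewrite big_ord_recr /= eqxx.
  under eq_bigr => j _ do rewrite ltn_eqF//.
  rewrite -/(rest i x') -/(a i) -[b i]addr0.
  have [ai|ai] := eqVneq (a i) 0.
    by have := x'P (inl i); rewrite A'l /= ai eqxx mul0r !addr0.
  rewrite bdP// mulr0 addr0 subr0.
  by case: ltrP ai => // ai ai0; [exact: zup|apply: zlo; rewrite lt_neqAle ai0].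
rewrite ltnS leq_eqVlt => /predU1P[->|jn].
  by rewrite eqxx mulrDl ler_wpDl// mulr_ge0.
by rewrite ltn_eqF// mulrDl -mulrA ler_wpDr ?mulr_ge0// x'x.
Qed.

Lemma hoffman_mx (R : realType) (k n : nat) (A : 'M[R]_(k, n)) :
  exists2 K : R, 0 <= K &
  forall (b : 'cV[R]_k) (v : R) (x : 'cV[R]_n), 0 <= v ->
    (exists x0 : 'cV[R]_n, vec_le (A *m x0) b) ->
    vec_le (A *m x) (b + const_mx v) ->
  exists2 x' : 'cV[R]_n, vec_le (A *m x') b &
    forall j, `|x' j 0 - x j 0| <= K * v.
Proof.
pose ext (f : 'I_n -> R) (j : nat) := oapp f 0 (insub j).
have extE f (j : 'I_n) : ext f j = f j by rewrite /ext valK.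
have mulE (x : 'cV[R]_n) i :
    \sum_(j < n) ext (A i) j * ext (x ^~ 0) j = (A *m x) i 0.
  by rewrite mxE; apply: eq_bigr => j _; rewrite !extE.
have [K K0 KP] := hoffman n (fun i => ext (A i)).
exists K => // b v x v0 [x0 x0P] xP.
have [||| x' [x'P x'x]] := KP (b ^~ 0) v (ext (x ^~ 0)).
- by [].
- by exists (ext (x0 ^~ 0)) => i; rewrite mulE.
- by move=> i; rewrite mulE; have := xP i; rewrite !mxE.
exists (\col_j x' j) => [i|j]; last by rewrite mxE -(extE (x ^~ 0)) x'x.
rewrite mxE; apply: le_trans (x'P i).
by apply: ler_sum => j _; rewrite extE mxE.
Qed.

(** * Closed and compact sets of column vectors *)

Lemma closed_fun_le (R : realType) (T : topologicalType) (f g : T -> R) :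
  continuous f -> continuous g -> closed [set x | f x <= g x].
Proof.
move=> cf cg.
rewrite (_ : [set x | _] = (fun x => g x - f x) @^-1` [set y | 0 <= y]).
  apply: preimage_closed; last exact: closed_ge.
  by move=> x _; apply: cvgB; [exact: cg|exact: cf].
by apply/seteqP; split => x /=; rewrite subr_ge0.
Qed.

Lemma closed_vec_le (R : realType) (T : topologicalType) (k : nat)
    (f g : T -> 'cV[R]_k) :
  (forall i, continuous (fun x => f x i 0)) ->
  (forall i, continuous (fun x => g x i 0)) ->
  closed [set x | vec_le (f x) (g x)].
Proof.
move=> cf cg.
rewrite (_ : [set x | _] = \bigcap_i [set x | f x i 0 <= g x i 0]).
  by apply: closed_bigI => i _; exact: closed_fun_le.
by apply/seteqP; split => x /= h i; [move=> _|]; exact: h.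
Qed.

Lemma continuous_mulmx_coord (R : realType) (k n : nat) (M : 'M[R]_(k, n)) i :
  continuous (fun x : 'cV[R]_n => (M *m x) i 0).
Proof.
rewrite (_ : (fun x => _) = (fun x : 'cV[R]_n => \sum_j M i j * x j 0)).
  apply: continuous_big => [|j _ x]; first exact: add_continuous.
  apply: (@cvgM _ _ (nbhs x)); first exact: cvg_cst.
  exact: coord_continuous.
by apply/funext => x; rewrite mxE.
Qed.

Definition cube {R : realType} {k : nat} (l h : R) : set 'cV[R]_k :=
  [set u | forall i, l <= u i 0 <= h].

Lemma cube_compact (R : realType) (k : nat) (l h : R) :
  compact (cube l h : set 'cV[R]_k).
Proof.
have C := @rV_compact R k (fun=> `[l, h]%classic) (fun=> @segment_compact R l h).
rewrite (_ : cube l h = trmx @` [set v : 'rV[R]_k | forall i, `[l, h]%classic (v ord0 i)]).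
  apply: continuous_compact; last exact: C.
  apply: continuous_subspaceT => v.
  move=> A /= /nbhs_ballP[e e0 eA]; apply/nbhs_ballP; exists e => // w [_ vw].
  by apply: eA; split=> // i j; rewrite !mxE.
apply/seteqP; split => [u ulh|_ [v vlh <-] i].
  exists u^T; last by rewrite trmxK.
  by move=> i; rewrite /= in_itv/= mxE.
by have := vlh i; rewrite /= in_itv /= mxE.
Qed.

(** * Mean ratios *)

Definition mean_ratio {R : realType} {k : nat} (u v : 'cV[R]_k) : R :=
  k%:R^-1 * \sum_i u i 0 / v i 0.

(** The common form of both objectives: with [p = (x - s^-, y + s^+)] it is
    the SBM objective at [a = (x, y)], with [p = (x + t^-, y - t^+)] the
    super-efficiency objective. *)
Definition ratio_quotient {R : realType} {m s : nat}
    (p a : 'cV[R]_m * 'cV[R]_s) : R :=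
  mean_ratio p.1 a.1 / mean_ratio p.2 a.2.

(** Domination up to a factor [t]; two-sided domination with [t] close to [1]
    measures closeness of activities in a scale-invariant way. *)
Definition dominates {R : realType} {m s : nat} (t : R)
    (p q : 'cV[R]_m * 'cV[R]_s) : Prop :=
  vec_le p.1 (t *: q.1) /\ vec_le q.2 (t *: p.2).

Lemma dominates1 (R : realType) (m s : nat) (p q : 'cV[R]_m * 'cV[R]_s) :
  dominates 1 p q <-> vec_le p.1 q.1 /\ vec_le q.2 p.2.
Proof. by rewrite /dominates !scale1r. Qed.

Lemma mean_ratio_gt0 (R : realType) (k : nat) (u v : 'cV[R]_k) : (0 < k)%N ->
  vec_lt 0 u -> vec_lt 0 v -> 0 < mean_ratio u v.
Proof.
case: k u v => // k u v _ u0 v0.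
rewrite /mean_ratio mulr_gt0// ?invr_gt0 ?ltr0n// big_ord_recl.
have uv i : 0 < u i 0 / v i 0.
  by have := u0 i; have := v0 i; rewrite !mxE => ? ?; rewrite divr_gt0.
by rewrite ltr_wpDr// sumr_ge0// => i _; exact: ltW.
Qed.

Lemma mean_ratio_id (R : realType) (k : nat) (v : 'cV[R]_k) : (0 < k)%N ->
  vec_lt 0 v -> mean_ratio v v = 1.
Proof.
move=> k0 v0; rewrite /mean_ratio (eq_bigr (fun=> 1)) => [|i _].
  by rewrite sumr_const card_ord mulVf// pnatr_eq0 -lt0n.
by have := v0 i; rewrite mxE => vi; rewrite divff// gt_eqF.
Qed.

Lemma mean_ratioD (R : realType) (k : nat) (u w v : 'cV[R]_k) :
  mean_ratio (u + w) v = mean_ratio u v + mean_ratio w v.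
Proof.
rewrite /mean_ratio -mulrDr -big_split /=; congr (_ * _).
by apply: eq_bigr => i _; rewrite mxE mulrDl.
Qed.

Lemma mean_ratioN (R : realType) (k : nat) (u v : 'cV[R]_k) :
  mean_ratio (- u) v = - mean_ratio u v.
Proof.
rewrite /mean_ratio -mulrN -sumrN; congr (_ * _).
by apply: eq_bigr => i _; rewrite mxE mulNr.
Qed.

Lemma mean_ratio_scale (R : realType) (k : nat) (t t' : R) (u u' v v' : 'cV[R]_k) :
  0 <= t -> 0 <= t' -> vec_lt 0 u' -> vec_lt 0 v -> vec_lt 0 v' ->
  vec_le u (t *: u') -> vec_le v' (t' *: v) ->
  mean_ratio u v <= (t * t') * mean_ratio u' v'.
Proof.
move=> t0 t'0 u'0 v0 v'0 uu' vv'; rewrite /mean_ratio mulrCA.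
rewrite ler_wpM2l ?invr_ge0 ?ler0n// mulr_sumr; apply: ler_sum => i _.
have := u'0 i; have := v0 i; have := v'0 i; have := uu' i; have := vv' i.
rewrite !mxE => h1 h2 h3 h4 h5.
apply: (@le_trans _ _ (t * u' i 0 / v i 0)).
  by rewrite ler_wpM2r// invr_ge0 ltW.
rewrite mulrACA ler_wpM2l ?mulr_ge0// ?(ltW h5)//.
by rewrite ler_pdivlMr// mulrC ler_pdivrMr.
Qed.

Lemma ratio_quotient_gt0 (R : realType) (m s : nat) (p a : 'cV[R]_m * 'cV[R]_s) :
  (0 < m)%N -> (0 < s)%N -> activity p -> activity a -> 0 < ratio_quotient p a.
Proof.
by move=> m0 s0 [p1 p2] [a1 a2]; rewrite divr_gt0 ?mean_ratio_gt0.
Qed.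

Lemma ratio_quotient_scale (R : realType) (m s : nat) (t t' : R)
    (p p' a a' : 'cV[R]_m * 'cV[R]_s) :
  (0 < m)%N -> (0 < s)%N -> 0 <= t -> 0 <= t' ->
  activity p -> activity p' -> activity a -> activity a' ->
  dominates t p p' -> dominates t' a' a ->
  ratio_quotient p a <= (t * t') ^+ 2 * ratio_quotient p' a'.
Proof.
move=> m0 s0 t0 t'0 [p1 p2] [p'1 p'2] [a1 a2] [a'1 a'2] [pp1 pp2] [aa1 aa2].
have N : mean_ratio p.1 a.1 <= t * t' * mean_ratio p'.1 a'.1.
  exact: mean_ratio_scale.
have D : mean_ratio p'.2 a'.2 <= t * t' * mean_ratio p.2 a.2.
  exact: mean_ratio_scale.
have tt0 : 0 <= t * t' by rewrite mulr_ge0.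
have D0 : 0 < mean_ratio p.2 a.2 by rewrite mean_ratio_gt0.
have D'0 : 0 < mean_ratio p'.2 a'.2 by rewrite mean_ratio_gt0.
have N'0 : 0 < mean_ratio p'.1 a'.1 by rewrite mean_ratio_gt0.
rewrite /ratio_quotient ler_pdivrMr//; apply: le_trans N _.
set n := mean_ratio p'.1 _ in N'0 *; set d := mean_ratio p.2 _ in D D0 *.
set d' := mean_ratio p'.2 _ in D D'0 *.
have -> : (t * t') ^+ 2 * (n / d') * d = t * t' * n * (t * t' * d / d') by ring.
by rewrite ler_peMr ?ler_pdivlMr ?mul1r// mulr_ge0// ltW.
Qed.

(** * Boxes of positive vectors *)

Definition box {R : realType} {m s : nat} (c B : R) : set ('cV[R]_m * 'cV[R]_s) :=
  cube c B `*` cube c B.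

Lemma box_activity (R : realType) (m s : nat) (c B : R)
    (a : 'cV[R]_m * 'cV[R]_s) : 0 < c -> box c B a -> activity a.
Proof.
move=> c0 [a1 a2].
by split=> i; rewrite mxE; [have /andP[] := a1 i|have /andP[] := a2 i];
  move=> ca _; exact: lt_le_trans ca.
Qed.

Lemma box_sub (R : realType) (m s : nat) (c B c' B' : R)
    (a : 'cV[R]_m * 'cV[R]_s) : c' <= c -> B <= B' -> box c B a -> box c' B' a.
Proof.
move=> cc BB [a1 a2]; split=> i.
  by have /andP[h1 h2] := a1 i; rewrite (le_trans cc)//= (le_trans h2).
by have /andP[h1 h2] := a2 i; rewrite (le_trans cc)//= (le_trans h2).
Qed.

Lemma cube_ex (R : realType) (k : nat) (u : 'cV[R]_k) : vec_lt 0 u ->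
  exists cB : R * R, 0 < cB.1 /\ cube cB.1 cB.2 u.
Proof.
move=> u0; exists (\big[Num.min/1]_i u i 0, \big[Num.max/0]_i u i 0) => /=.
split=> [|i].
  by apply/lt_bigmin => // i _; have := u0 i; rewrite mxE.
by apply/andP; split; [exact: bigmin_le|exact: (le_bigmax 0 (fun i => u i 0))].
Qed.

Lemma activity_box (R : realType) (m s : nat) (a : 'cV[R]_m * 'cV[R]_s) :
  activity a -> exists cB : R * R, 0 < cB.1 /\ box cB.1 cB.2 a.
Proof.
move=> [/cube_ex[[c B] /= [c0 a1]] /cube_ex[[c' B'] /= [c'0 a2]]].
exists (Num.min c c', Num.max B B'); rewrite /= lt_min c0 c'0; split=> //.
split=> i.
  have /andP[h1 h2] := a1 i.
  by rewrite ge_min h1 le_max h2.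
have /andP[h1 h2] := a2 i.
by rewrite ge_min h1 le_max h2 !orbT.
Qed.

(** * Multiplicative continuity *)

(** Near a positive vector, neighbourhoods are described by mutual domination
    up to a factor [t > 1], and [t ^+ N] tends to [1] with [t]. *)
Lemma log_lipschitz_continuous (R : realType) (m s : nat)
    (S : set ('cV[R]_m * 'cV[R]_s)) (F : 'cV[R]_m * 'cV[R]_s -> R) :
  S `<=` activity -> (forall a, S a -> 0 <= F a) ->
  (forall a, S a -> exists N, forall t a', 1 <= t <= 2 -> S a' ->
     dominates t a a' -> dominates t a' a ->
     F a' <= t ^+ N * F a /\ F a <= t ^+ N * F a') ->
  {within S, continuous F}.
Proof.
move=> SA F0 FL; apply/subspace_continuousP => a Sa.
have [N NP] := FL a Sa.
apply/cvgrPdist_lt => e e0.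
(* The values at points within a factor [t] differ by at most
   [t ^+ N * (t ^+ N - 1) * F a], which tends to 0 as [t] tends to 1. *)
have [t [/andP[t1 t2] te]] : exists t : R, 1 < t <= 2 /\
    t ^+ N * (t ^+ N - 1) * F a < e.
  pose h (t : R) := t ^+ N * (t ^+ N - 1) * F a.
  have hc : h t @[t --> (1:R)] --> h 1.
    apply: cvgM; last exact: cvg_cst.
    have pc : (t ^+ N @[t --> (1:R)] --> (1:R) ^+ N) by exact: exprn_continuous.
    have pB : (t ^+ N - 1 @[t --> (1:R)] --> (1:R) ^+ N - 1).
      by apply: cvgB; [exact: pc|exact: cvg_cst].
    exact: (cvgM pc pB).
  have h1 : h 1 < e by rewrite /h expr1n subrr mulr0 mul0r.
  have hr : h t @[t --> (1:R)^'+] --> h 1 by exact/cvg_at_right_filter/hc.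
  have hre := @cvgr_lt _ _ _ _ h (h 1) hr e h1.
  have : \forall t \near (1 : R)^'+, 1 < t <= 2 /\ h t < e.
    near=> t; split; last by near: t; exact: hre.
    apply/andP; split; near: t; first exact: nbhs_right_gt.
    by apply: nbhs_right_le; rewrite ltr1n.
  by move=> /filter_ex[t tP]; exists t.
have aA := SA _ Sa.
have t0 : 0 < t by apply: lt_trans t1.
have near_a k (f : 'cV[R]_m * 'cV[R]_s -> 'cV[R]_k) : continuous f -> vec_lt 0 (f a) ->
    \forall a' \near a, vec_le (f a) (t *: f a') /\ vec_le (f a') (t *: f a).
  move=> cf fa0; have cfi i : f b i 0 @[b --> a] --> f a i 0.
    apply: (@continuous_comp _ _ _ f (fun u : 'cV[R]_k => u i 0)).
      exact: cf.
    exact: coord_continuous.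
  apply: filterI.
    apply: (@filter_forall _ _ (fun i => [set b | f a i 0 <= (t *: f b) i 0]) (nbhs a)) => i.
    have := fa0 i; rewrite mxE => fai0.
    have : t^-1 * f a i 0 < f a i 0 by rewrite gtr_pMl// invf_lt1.
    move=> /(@cvgr_gt _ _ _ _ (fun b => f b i 0) _ (cfi i)).
    by apply: filterS => b /=; rewrite mxE ltr_pdivrMl// => /ltW.
  apply: (@filter_forall _ _ (fun i => [set b | f b i 0 <= (t *: f a) i 0]) (nbhs a)) => i.
  have := fa0 i; rewrite mxE => fai0.
  have : f a i 0 < t * f a i 0 by rewrite ltr_pMl.
  move=> /(@cvgr_lt _ _ _ _ (fun b => f b i 0) _ (cfi i)).
  by apply: filterS => b /=; rewrite mxE => /ltW.
have n1 : \forall a' \near a, vec_le a.1 (t *: a'.1) /\ vec_le a'.1 (t *: a.1).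
  by apply: (near_a _ fst); [move=> z; exact: cvg_fst|exact: aA.1].
have n2 : \forall a' \near a, vec_le a.2 (t *: a'.2) /\ vec_le a'.2 (t *: a.2).
  by apply: (near_a _ snd); [move=> z; exact: cvg_snd|exact: aA.2].
rewrite near_withinE; apply: filterS2 n1 n2 => a' [h1 h2] [h3 h4] Sa'.
have t12 : 1 <= t <= 2 by rewrite ltW.
have [k1 k2] := NP t a' t12 Sa' (conj h1 h4) (conj h2 h3).
have T1 : 0 <= t ^+ N - 1 by rewrite subr_ge0 exprn_ege1// ltW.
have Fa := F0 _ Sa; have Fa' := F0 _ Sa'.
have k3 : (t ^+ N - 1) * F a' <= (t ^+ N - 1) * (t ^+ N * F a) by rewrite ler_wpM2l.
have k4 : 0 <= (t ^+ N - 1) * ((t ^+ N - 1) * F a) by rewrite !mulr_ge0.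
change (`|F a - F a'| < e).
rewrite ltr_distl; apply/andP; split; lra.
Unshelve. all: by end_near. Qed.

(** * Nonnegative combinations of positive columns *)

Definition weight {R : realType} {n : nat} (lam : 'cV[R]_n) : R :=
  \sum_j lam j 0.

Lemma mulmx_weight (R : realType) (k n : nat) (M : 'M[R]_(k, n)) (lo hi : R)
    (lam : 'cV[R]_n) : (forall i j, lo <= M i j <= hi) -> vec_le 0 lam ->
  cube (lo * weight lam) (hi * weight lam) (M *m lam).
Proof.
move=> Mb l0 i; rewrite mxE !mulr_sumr.
by apply/andP; split; apply: ler_sum => j _; have /andP[h1 h2] := Mb i j;
  rewrite ler_wpM2r//; have := l0 j; rewrite mxE.
Qed.

Lemma mulmx_lip (R : realType) (k n : nat) (M : 'M[R]_(k, n)) (hi d : R)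
    (lam mu : 'cV[R]_n) : (forall i j, `|M i j| <= hi) ->
  (forall j, `|lam j 0 - mu j 0| <= d) ->
  forall i, `|(M *m lam) i 0 - (M *m mu) i 0| <= n%:R * (hi * d).
Proof.
move=> Mb lm i; rewrite !mxE -sumrB.
apply: le_trans (ler_norm_sum _ _ _) _.
rewrite -[n in leRHS]card_ord mulr_natl -sumr_const; apply: ler_sum => j _.
by rewrite -mulrBr normrM ler_pM.
Qed.

Lemma Bernoulli (R : realType) (N : nat) (t : R) : 1 <= t ->
  1 + N%:R * (t - 1) <= t ^+ N.
Proof.
move=> t1; elim: N => [|N IH]; first by rewrite mul0r addr0 expr0.
rewrite exprS; apply: (@le_trans _ _ (t * (1 + N%:R * (t - 1)))); last first.
  by rewrite ler_wpM2l// (le_trans _ t1).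
have : 0 <= N%:R * (t - 1) ^+ 2 :> R by rewrite mulr_ge0 ?sqr_ge0.
rewrite -natr1; nra.
Qed.

(** * The technology spanned by the reference activities *)
Section Technology.
Variables (R : realType) (m s n : nat).
(* The data enter only through uniform positive bounds on their entries. *)
Variables (X : 'M[R]_(m, n)) (Y : 'M[R]_(s, n)) (lo hi : R).
Hypotheses (m0 : (0 < m)%N) (s0 : (0 < s)%N) (n0 : (0 < n)%N).
Hypotheses (lo0 : 0 < lo) (lohi : lo <= hi).
Hypotheses (Xb : forall i j, lo <= X i j <= hi).
Hypotheses (Yb : forall r j, lo <= Y r j <= hi).

Local Notation io_pair := ('cV[R]_m * 'cV[R]_s)%type.
Local Notation P := (production_set X Y).

Let hi0 : 0 < hi. Proof. exact: lt_le_trans lohi. Qed.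

Definition blend (lam : 'cV[R]_n) : io_pair := (X *m lam, Y *m lam).

Lemma production_setP b : P b <->
  activity b /\ exists2 lam, vec_le 0 lam & dominates 1 (blend lam) b.
Proof.
split=> [[bA [lam [l0 lx ly]]]|[bA [lam l0 /dominates1[lx ly]]]].
  by split=> //; exists lam => //; apply/dominates1.
by split=> //; exists lam.
Qed.

Lemma dominated_setP a b : dominated_set X Y a b <-> P b /\ dominates 1 a b.
Proof.
split=> [[Pb ab1 ab2]|[Pb /dominates1[ab1 ab2]]]; last by split.
by split=> //; apply/dominates1.
Qed.

Lemma blend_gt0 lam : vec_le 0 lam -> 0 < weight lam -> activity (blend lam).
Proof.
move=> l0 w0; split=> i; rewrite mxE.
  have /andP[+ _] := mulmx_weight Xb l0 i.
  by apply: lt_le_trans; rewrite mulr_gt0.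
have /andP[+ _] := mulmx_weight Yb l0 i.
by apply: lt_le_trans; rewrite mulr_gt0.
Qed.

Lemma weight_gt0 lam b : activity b -> vec_le 0 lam ->
  dominates 1 (blend lam) b -> 0 < weight lam.
Proof.
move=> [_ b2] l0 /dominates1[_ lb]; pose r : 'I_s := Ordinal s0.
have := lt_le_trans (b2 r) (lb r); rewrite mxE => y0.
have /andP[_] := mulmx_weight Yb l0 r => /(lt_le_trans y0).
by rewrite pmulr_rgt0.
Qed.

Lemma blend_activity lam b : activity b -> vec_le 0 lam ->
  dominates 1 (blend lam) b -> activity (blend lam).
Proof. by move=> bA l0 lb; apply: blend_gt0 => //; exact: weight_gt0 lb. Qed.

Lemma weight_le lam b B : vec_le 0 lam -> dominates 1 (blend lam) b ->
  (forall i, b.1 i 0 <= B) -> weight lam <= B / lo.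
Proof.
move=> l0 /dominates1[lb _] bB; rewrite ler_pdivlMr// mulrC.
have /andP[+ _] := mulmx_weight Xb l0 (Ordinal m0); move/le_trans; apply.
exact: le_trans (lb _) (bB _).
Qed.

Lemma coord_le_weight (lam : 'cV[R]_n) j : vec_le 0 lam -> lam j 0 <= weight lam.
Proof.
move=> l0; apply: (@ler_term_sum _ _ (fun j => lam j 0)) => i.
by have := l0 i; rewrite mxE.
Qed.

Lemma compact_feasible b : compact [set lam | vec_le 0 lam /\ dominates 1 (blend lam) b].
Proof.
pose B := \sum_i `|b.1 i 0|.
have C : compact (cube 0 (B / lo) : set 'cV[R]_n) by exact: cube_compact.
apply: subclosed_compact _ C _.
  rewrite (_ : [set lam | _] = [set lam | vec_le 0 lam] `&`
     ([set lam | vec_le (X *m lam) b.1] `&` [set lam | vec_le b.2 (Y *m lam)])).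
    apply: closedI; first apply: closed_vec_le => i.
    - by apply: cst_continuous.
    - exact: coord_continuous.
    apply: closedI; apply: closed_vec_le => i.
    - exact: continuous_mulmx_coord.
    - by apply: cst_continuous.
    - by apply: cst_continuous.
    - exact: continuous_mulmx_coord.
  by apply/seteqP; split => lam /=; rewrite dominates1.
move=> lam [l0 lb] j; apply/andP; split; first by have := l0 j; rewrite mxE.
apply: le_trans (coord_le_weight _ l0) _; apply: weight_le lb _ => // i.
by apply: le_trans (ler_norm _) _; exact: (@ler_term_sum _ _ (fun i => `|b.1 i 0|)).
Qed.

Lemma continuous_mean_ratio_mulmx k (M : 'M[R]_(k, n)) (v : 'cV[R]_k) :
  continuous (fun lam => mean_ratio (M *m lam) v).
Proof.
move=> lam; apply: (@cvgM _ _ (nbhs lam)); first exact: cvg_cst.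
apply: cvg_big => [|i _]; first exact: add_continuous.
apply: (@cvgM _ _ (nbhs lam)); last exact: cvg_cst.
exact: continuous_mulmx_coord.
Qed.

(** * The SBM score *)

Lemma sbm_feasible_ratio b lam sl : activity b ->
  b.1 = X *m lam + sl.1 -> b.2 = Y *m lam - sl.2 ->
  sbm_rho b sl = ratio_quotient (blend lam) b.
Proof.
move=> [b1 b2] e1 e2.
have Xl : X *m lam = b.1 - sl.1 by rewrite e1 addrK.
have Yl : Y *m lam = b.2 + sl.2 by rewrite e2 subrK.
by rewrite /ratio_quotient /= Xl Yl !mean_ratioD mean_ratioN !mean_ratio_id.
Qed.

Lemma sbm_scoreP b : P b -> exists lam, [/\ vec_le 0 lam,
  dominates 1 (blend lam) b, sbm_score X Y b = ratio_quotient (blend lam) b &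
  forall mu, vec_le 0 mu -> dominates 1 (blend mu) b ->
    sbm_score X Y b <= ratio_quotient (blend mu) b].
Proof.
move=> Pb; have [bA [lam0 l00 lb0]] := (production_setP _).1 Pb.
have [||lam] := @compact_EVT_min _ R (fun lam => ratio_quotient (blend lam) b) _ _
  (@compact_feasible b).
- by exists lam0.
- apply: continuous_in_subspaceT => lam; rewrite inE => -[l0 lb].
  have [_ y0] := blend_activity bA l0 lb.
  apply: (@cvgM _ _ (nbhs lam)); first exact: continuous_mean_ratio_mulmx.
  apply: (@cvgV _ _ (nbhs lam)); last exact: continuous_mean_ratio_mulmx.
  by rewrite gt_eqF// mean_ratio_gt0//; exact: bA.2.
rewrite inE => -[l0 lb] lmin.
have scoreE : sbm_score X Y b = ratio_quotient (blend lam) b.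
  rewrite /sbm_score mem_set//; apply: set_minE.
    exists (b.1 - X *m lam, Y *m lam - b.2).
      exists lam; have [l1 l2] := (dominates1 _ _).1 lb; split=> //=.
      - by move=> i; have := l1 i; rewrite !mxE subr_ge0.
      - by move=> i; have := l2 i; rewrite !mxE subr_ge0.
      - by rewrite addrC subrK.
      - by rewrite opprB addrC subrK.
    apply: sbm_feasible_ratio => //=; first by rewrite addrC subrK.
    by rewrite opprB addrC subrK.
  move=> _ [sl [mu [mu0 sl0 sl0' e1 e2]] <-].
  rewrite (sbm_feasible_ratio bA e1 e2); apply: lmin; rewrite inE; split=> //.
  apply/dominates1; split=> i; rewrite /= ?e1 ?e2.
    by rewrite [leRHS]mxE lerDl; have := sl0 i; rewrite mxE.
  by rewrite mxE gerDl mxE oppr_le0; have := sl0' i; rewrite mxE.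
exists lam; split=> // mu mu0 mub; rewrite scoreE.
by apply: lmin; rewrite inE.
Qed.


Lemma box_le c B (a : io_pair) : box c B a -> c <= B.
Proof. by case=> /(_ (Ordinal m0))/andP[h1 h2] _; exact: le_trans h2. Qed.

(** The constraints of [b'] are tighter than those of [b] by at most a factor
    [t], so a solution for [b] violates them by at most [(t - 1) * B], and the error bound moves it to a
    solution [lam'] by a multiple of [t - 1].  The entries of [X lam] and of
    [Y lam'] are bounded below on the box, which turns this additive error
    into a factor [1 + C * (t - 1)], and Bernoulli's inequality absorbs the
    latter into a power of [t]. *)
Lemma feasible_stable c B : 0 < c -> exists N, forall t b b' lam, 1 <= t ->
  P b' -> box c B b -> box c B b' -> dominates t b b' ->
  vec_le 0 lam -> dominates 1 (blend lam) b ->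
  exists lam', [/\ vec_le 0 lam', dominates 1 (blend lam') b' &
                   dominates (t ^+ N) (blend lam') (blend lam)].
Proof.
move=> c0.
pose A : 'M[R]_(n + (m + s), n) := col_mx (- 1%:M) (col_mx X (- Y)).
pose rhs (b : io_pair) : 'cV[R]_(n + (m + s)) := col_mx 0 (col_mx b.1 (- b.2)).
have AE lam b v : vec_le (A *m lam) (rhs b + const_mx v) <->
    [/\ forall j, - v <= lam j 0, forall i, (X *m lam) i 0 <= b.1 i 0 + v &
        forall r, b.2 r 0 - v <= (Y *m lam) r 0].
  rewrite /A /rhs !mul_col_mx -!col_mx_const !add_col_mx !mulNmx mul1mx.
  split=> [h|[h1 h2 h3] i].
    split=> [j|i|r].
    - have := h (lshift _ j); rewrite !col_mxEu !mxE; lra.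
    - by have := h (rshift _ (lshift _ i)); rewrite !col_mxEd !col_mxEu [leRHS]mxE [X in _ + X]mxE.
    - have := h (rshift _ (rshift _ r)); rewrite !col_mxEd [leRHS]mxE.
      rewrite [X in X + _]mxE [X in _ + X]mxE [leLHS]mxE; lra.
  have [j ->|k ->] := split_ordP i.
    have := h1 j; rewrite !col_mxEu !mxE; lra.
  have [i' ->|r ->] := split_ordP k; rewrite !col_mxEd ?col_mxEu ?col_mxEd.
    by rewrite [leRHS]mxE [X in _ + X]mxE.
  rewrite [leRHS]mxE [X in X + _]mxE [X in _ + X]mxE [leLHS]mxE.
  have := h3 r; lra.
have A0E lam b : vec_le (A *m lam) (rhs b) <->
    vec_le 0 lam /\ dominates 1 (blend lam) b.
  have -> : rhs b = rhs b + const_mx 0 by apply/matrixP => i j; rewrite !mxE addr0.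
  rewrite AE dominates1 /vec_le /=; split=> [[h1 h2 h3]|[h1 [h2 h3]]].
    split=> [j|]; first by rewrite mxE -oppr0.
    by split=> i; [rewrite -[leRHS]addr0|rewrite -[leLHS]subr0].
  by split=> i; rewrite ?addr0 ?subr0 ?oppr0//; have := h1 i; rewrite mxE.
have [K K0 KP] := hoffman_mx A.
(* [e] bounds the entries of [X lam] and [Y lam'] from below. *)
pose e := lo * (c / hi).
have e0 : 0 < e by rewrite mulr_gt0 ?divr_gt0.
have ec : e <= c by rewrite /e mulrCA ler_piMr ?(ltW c0)// ler_pdivrMr// mul1r.
pose C := n%:R * (hi * (K * `|B|)) / e.
have C0 : 0 <= C by rewrite divr_ge0 ?(ltW e0)// !mulr_ge0// ltW.
exists (Num.bound C) => t b b' lam t1 Pb' bb bb' dbb l0 lb.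
have B0 : 0 <= B by apply: le_trans (box_le bb); exact: ltW.
have t10 : 0 <= t - 1 by rewrite subr_ge0.
pose v := (t - 1) * B.
have v0 : 0 <= v by rewrite mulr_ge0.
have [lb1 lb2] := (dominates1 _ _).1 lb.
have [||| lam' lam'P lamlam'] := KP (rhs b') v lam.
- by [].
- by have [_ [mu mu0 mub]] := (production_setP _).1 Pb'; exists mu; apply/A0E.
- apply/AE; split=> [j|i|r].
  + by have := l0 j; rewrite mxE; apply: le_trans; rewrite oppr_le0.
  + apply: le_trans (lb1 i) _; have := dbb.1 i; rewrite mxE => /le_trans; apply.
    have /andP[h1 h2] := bb'.1 i.
    rewrite /v; nra.
  + rewrite lerBlDr; apply: le_trans (dbb.2 r) _; rewrite mxE.
    have /andP[h1 h2] := bb.2 r; have /= h3 := lb2 r.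
    rewrite /v; nra.
have [l'0 lb'] := (A0E _ _).1 lam'P.
exists lam'; split=> //.
pose st := t ^+ Num.bound C.
have st0 : 0 <= st - 1 by rewrite subr_ge0 exprn_ege1.
have est : n%:R * (hi * (K * v)) <= e * (st - 1).
  have -> : n%:R * (hi * (K * v)) = e * (C * (t - 1)).
    rewrite /C /v ger0_norm//; field; exact: lt0r_neq0.
  rewrite ler_wpM2l ?(ltW e0)// lerBrDl.
  apply: le_trans (Bernoulli (Num.bound C) t1); rewrite lerD2l ler_wpM2r//.
  by apply/ltW; exact: archi_boundP.
have ew : e <= lo * weight lam.
  rewrite ler_pM2l// ler_pdivrMr// mulrC.
  pose r : 'I_s := Ordinal s0.
  have /andP[cb _] := bb.2 r; apply: (le_trans cb); apply: le_trans (lb2 r) _.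
  by have /andP[] := mulmx_weight Yb l0 r.
have normM k (M : 'M[R]_(k, n)) : (forall i j, lo <= M i j <= hi) ->
    forall i, `|(M *m lam') i 0 - (M *m lam) i 0| <= e * (st - 1).
  move=> Mb i; apply: le_trans est; apply: mulmx_lip => // i' j.
  by have /andP[h1 h2] := Mb i' j; rewrite ger0_norm// (le_trans (ltW lo0)).
split=> i; rewrite [leRHS]mxE /= -/st.
  have := normM _ _ Xb i; rewrite ler_distl => /andP[_ h].
  have /andP[h' _] := mulmx_weight Xb l0 i.
  have h3 : e * (st - 1) <= (X *m lam) i 0 * (st - 1).
    by rewrite ler_wpM2r// (le_trans ew).
  lra.
have := normM _ _ Yb i; rewrite ler_distl => /andP[h _].
have /andP[h' _] := bb'.2 i; have h'' := ((dominates1 _ _).1 lb').2 i.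
have h3 : e * (st - 1) <= (Y *m lam') i 0 * (st - 1).
  by rewrite ler_wpM2r// (le_trans ec)// (le_trans h').
lra.
Qed.

(** * Functions with bounded logarithmic growth along domination *)

(** In logarithmic terms, [ln F] rises from [b] to [b'] by at most
    [N * ln t] when [b] dominates [b'] up to [t].  The condition is one-sided,
    so that [t = 1] includes monotonicity: better activities have greater
    values. *)
Definition log_lipschitz (F : io_pair -> R) : Prop :=
  (forall b, P b -> 0 <= F b) /\
  forall c B, 0 < c -> exists N, forall t b b', 1 <= t -> P b -> P b' ->
    box c B b -> box c B b' -> dominates t b b' -> F b' <= t ^+ N * F b.

(** The case [t = 1], in a box large enough to contain both activities. *)
Lemma log_lipschitz_antitone F b b' : log_lipschitz F -> P b -> P b' ->
  dominates 1 b b' -> F b' <= F b.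
Proof.
move=> [_ FL] Pb Pb' bb'.
have [[c B] /= [c0 cb]] := activity_box ((production_setP _).1 Pb).1.
have [[c' B'] /= [c'0 cb']] := activity_box ((production_setP _).1 Pb').1.
have [|N NP] := FL (Num.min c c') (Num.max B B').
  by rewrite lt_min c0.
have := NP 1 b b'; rewrite expr1n mul1r; apply=> //.
  by apply: box_sub cb; rewrite ?ge_min ?le_max lexx.
by apply: box_sub cb'; rewrite ?ge_min ?le_max lexx orbT.
Qed.

(** An optimal [lam] for [b] is transported to [b'] by [feasible_stable]; its
    objective value changes by a power of [t]. *)
Lemma sbm_score_log_lipschitz : log_lipschitz (sbm_score X Y).
Proof.
split=> [b Pb|c B c0].
  have [lam [l0 lb -> _]] := sbm_scoreP Pb.
  have [bA _] := (production_setP _).1 Pb.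
  by apply/ltW/ratio_quotient_gt0 => //; exact: blend_activity lb.
have [N NP] := feasible_stable B c0.
exists ((N + 1) * 2)%N => t b b' t1 Pb Pb' bb bb' tbb'.
have [lam [l0 lb -> _]] := sbm_scoreP Pb.
have [lam' [l'0 lb' ll']] := NP t b b' lam t1 Pb' bb bb' tbb' l0 lb.
have [_ [_ _ _ /(_ _ l'0 lb')]] := sbm_scoreP Pb'.
move/le_trans; apply; rewrite exprM addn1 [t ^+ N.+1]exprSr.
have t0 : 0 <= t by apply: le_trans t1.
have bA := box_activity c0 bb; have bA' := box_activity c0 bb'.
have lA := blend_activity bA l0 lb.
have lA' := blend_activity bA' l'0 lb'.
by apply: ratio_quotient_scale => //; rewrite exprn_ge0.
Qed.

(** Inverting the super-efficiency objective turns its minimum into a maximum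
    of the same kind as that of the SBM score. *)
Lemma ratio_quotient_log_lipschitz a : activity a ->
  log_lipschitz (fun b => (ratio_quotient b a)^-1).
Proof.
move=> aA; have pos b : P b -> 0 < ratio_quotient b a.
  by move=> /production_setP[bA _]; exact: ratio_quotient_gt0.
split=> [b Pb|c B c0]; first by rewrite invr_ge0 ltW// pos.
exists 2%N => t b b' t1 Pb Pb' bb bb' tbb'.
have t0 : 0 <= t by apply: le_trans t1.
have /production_setP[bA _] := Pb; have /production_setP[bA' _] := Pb'.
have : ratio_quotient b a <= (t * 1) ^+ 2 * ratio_quotient b' a.
  by apply: ratio_quotient_scale => //; apply/dominates1; split=> i.
rewrite mulr1 => h; rewrite ler_pdivlMr ?pos//.
by rewrite ler_pdivrMl ?pos// mulrC.
Qed.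

(** * Best dominated activities *)

(** The factor by which a box must grow to contain optimal dominated
    activities. *)
Definition kappa := hi / lo.

Let kappa1 : 1 <= kappa. Proof. by rewrite ler_pdivlMr// mul1r. Qed.
Let kappa0 : 0 < kappa. Proof. exact: lt_le_trans kappa1. Qed.

(** Among the pairs that both [a] and [p] dominate, the best one. *)
Definition envelope (a p : io_pair) : io_pair :=
  (\col_i Num.max (a.1 i 0) (p.1 i 0), \col_r Num.min (a.2 r 0) (p.2 r 0)).

Lemma envelope_dominated a mu : activity a -> vec_le 0 mu -> 0 < weight mu ->
  dominated_set X Y a (envelope a (blend mu)).
Proof.
move=> [a1 a2] mu0 w0; have [x0 y0] := blend_gt0 mu0 w0.
apply/dominated_setP; split; last first.
  by apply/dominates1; split=> i; rewrite mxE ?le_max ?ge_min lexx.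
apply/production_setP; split.
  split=> i; rewrite mxE [ltRHS]mxE.
    by have := a1 i; rewrite mxE => a1i; rewrite lt_max a1i.
  by have := a2 i; have := y0 i; rewrite !mxE => y0i a2i; rewrite lt_min a2i.
exists mu => //; apply/dominates1.
split=> i; first by rewrite [leRHS]mxE le_max lexx orbT.
by rewrite [leLHS]mxE ge_min lexx orbT.
Qed.

Lemma dominated_set_nonempty a : activity a -> dominated_set X Y a !=set0.
Proof.
move=> aA; exists (envelope a (blend (const_mx 1))); apply: envelope_dominated => //.
  by move=> j; rewrite !mxE.
rewrite /weight; under eq_bigr do rewrite mxE.
by rewrite sumr_const card_ord ltr0n.
Qed.

(** Let [lam] produce [b].  If its weight exceeds [B / lo], it can be scaled
    down to that weight while still covering all outputs of [a]; if it is below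
    [c / hi], it can be scaled up to that weight while still using no more than
    the inputs of [a].  In each case the resulting envelope is at least as good
    as [b], and the weight in between confines it to a box. *)
Lemma dominated_set_box a b c B : 0 < c -> box c B a ->
  dominated_set X Y a b -> exists b', [/\ dominated_set X Y a b',
    box (c / kappa) (B * kappa) b' & dominates 1 b' b].
Proof.
move=> c0 ab /dominated_setP[/production_setP[bA [lam l0 lb]] /dominates1[ab1 ab2]].
have cB := box_le ab; have B0 := lt_le_trans c0 cB.
have w0 := weight_gt0 bA l0 lb.
have [lb1 lb2] := (dominates1 _ _).1 lb.
(* The weight of [lam], clamped to the interval from [c / hi] to [B / lo]. *)
pose w := Num.max (c / hi) (Num.min (weight lam) (B / lo)).
have chBl : c / hi <= B / lo.
  by rewrite ler_pM ?(ltW c0) ?invr_ge0 ?(ltW hi0)// lef_pV2.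
have wlo : c / hi <= w by rewrite le_max lexx.
have whi : w <= B / lo by rewrite ge_max chBl ge_min lexx orbT.
have w_lt : w < weight lam -> w = B / lo.
  by rewrite /w minEle; case: ifP => _; rewrite ?gt_max ?ltxx ?andbF// max_r.
have w_gt : weight lam < w -> w = c / hi.
  rewrite /w lt_max => /orP[h|]; last by rewrite lt_min ltxx.
  by rewrite max_l// ge_min (ltW h).
pose mu := (w / weight lam) *: lam.
have w'0 : 0 < w by apply: lt_le_trans wlo; rewrite divr_gt0.
have k0 : 0 <= w / weight lam by rewrite divr_ge0 ?(ltW w0)// ltW.
have mu0 : vec_le 0 mu.
  by move=> j; have := l0 j; rewrite !mxE => lj; rewrite mulr_ge0.
have muw : weight mu = w.
  rewrite /weight /mu; under eq_bigr do rewrite mxE.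
  by rewrite -mulr_sumr -/(weight lam) divfK// gt_eqF.
have muE k (M : 'M[R]_(k, n)) i : (M *m mu) i 0 = w / weight lam * (M *m lam) i 0.
  by rewrite /mu -scalemxAr mxE.
have hiw : hi * w <= B * kappa.
  have -> : B * kappa = hi * (B / lo) by rewrite /kappa mulrCA.
  by rewrite ler_pM2l.
have low : c / kappa <= lo * w.
  have -> : c / kappa = lo * (c / hi) by rewrite /kappa invf_div mulrCA.
  by rewrite ler_pM2l.
have ck : c / kappa <= c by rewrite ler_pdivrMr// ler_peMr// ltW.
have Bk : B <= B * kappa by rewrite ler_peMr// ltW.
have aA := box_activity c0 ab.
exists (envelope a (blend mu)); split; first by apply: envelope_dominated; rewrite ?muw.
  split=> i; rewrite mxE.
    have /andP[h1 h2] := ab.1 i; have /andP[_ h3] := mulmx_weight Xb mu0 i.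
    rewrite muw in h3.
    by rewrite le_max (le_trans ck h1)/= ge_max (le_trans h2)//= (le_trans h3).
  have /andP[h1 h2] := ab.2 i; have /andP[h3 _] := mulmx_weight Yb mu0 i.
  rewrite muw in h3.
  by rewrite le_min (le_trans ck h1)/= ge_min (le_trans low)//= (le_trans h2).
apply/dominates1; split=> i.
  rewrite [leLHS]mxE ge_max ab1/=.
  have [ww|/w_gt ww] := lerP w (weight lam).
    have := lb1 i; apply: le_trans; rewrite [leLHS]muE ler_piMl//.
      have /andP[h _] := mulmx_weight Xb l0 i.
      by apply: le_trans h; rewrite mulr_ge0// ltW.
    by rewrite ler_pdivrMr// mul1r.
  have /andP[_ h] := mulmx_weight Xb mu0 i.
  apply: (le_trans h); rewrite muw ww mulrCA divff ?gt_eqF// mulr1.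
  by have /andP[h1 _] := ab.1 i; exact: le_trans (ab1 i).
rewrite [leRHS]mxE le_min ab2/=.
have [ww|/w_lt ww] := lerP (weight lam) w.
  apply: le_trans (lb2 i) _; rewrite [leRHS]muE ler_peMl//.
    have /andP[h _] := mulmx_weight Yb l0 i.
    by apply: le_trans h; rewrite mulr_ge0// ltW.
  by rewrite ler_pdivlMr// mul1r.
have /andP[h _] := mulmx_weight Yb mu0 i.
apply: le_trans h; rewrite muw ww mulrCA divff ?gt_eqF// mulr1.
by have /andP[_ h2] := ab.2 i; exact: le_trans h2.
Qed.

(** A projection of a compact set of pairs [(b, lam)]: production imposes closed
    conditions on the pair, and the inputs of [b] bound [lam]. *)
Lemma compact_dominated a c B : 0 < c ->
  compact (dominated_set X Y a `&` box c B).
Proof.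
move=> c0.
pose K : set (io_pair * 'cV[R]_n) := box c B `*` cube 0 (B / lo).
have KC : compact K.
  by apply: compact_setX; [apply: compact_setX|]; exact: cube_compact.
pose D : set (io_pair * 'cV[R]_n) := [set z | vec_le (X *m z.2) z.1.1] `&`
  [set z | vec_le z.1.2 (Y *m z.2)] `&`
  ([set z | vec_le a.1 z.1.1] `&` [set z | vec_le z.1.2 a.2]).
have c1 i : continuous (fun z : io_pair * 'cV[R]_n => z.1.1 i 0).
  move=> z; apply: (@continuous_comp _ _ _ (fun z => z.1.1) (fun u : 'cV[R]_m => u i 0)).
    by apply: (@continuous_comp _ _ _ fst fst); exact: cvg_fst.
  exact: coord_continuous.
have c2 i : continuous (fun z : io_pair * 'cV[R]_n => z.1.2 i 0).
  move=> z; apply: (@continuous_comp _ _ _ (fun z => z.1.2) (fun u : 'cV[R]_s => u i 0)).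
    by apply: (@continuous_comp _ _ _ fst snd); [exact: cvg_fst|exact: cvg_snd].
  exact: coord_continuous.
have c3 k (M : 'M[R]_(k, n)) i :
    continuous (fun z : io_pair * 'cV[R]_n => (M *m z.2) i 0).
  move=> z; apply: (@continuous_comp _ _ _ snd (fun u : 'cV[R]_n => (M *m u) i 0)).
    exact: cvg_snd.
  exact: continuous_mulmx_coord.
have DC : closed D.
  apply: closedI; apply: closedI.
  - by apply: closed_vec_le => i; [exact: c3|exact: c1].
  - by apply: closed_vec_le => i; [exact: c2|exact: c3].
  - by apply: closed_vec_le => i; [apply: cst_continuous|exact: c1].
  - by apply: closed_vec_le => i; [exact: c2|apply: cst_continuous].
rewrite (_ : _ `&` _ = fst @` (D `&` K)).
  apply: continuous_compact; last by rewrite setIC; exact: compact_closedI.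
  by apply: continuous_subspaceT => z; exact: cvg_fst.
apply/seteqP; split.
  move=> b [/dominated_setP[/production_setP[bA [lam l0 lb]] /dominates1[ab1 ab2]] bb].
  exists (b, lam) => //=; have [lb1 lb2] := (dominates1 _ _).1 lb.
  split=> //; split=> // j; apply/andP; split; first by have := l0 j; rewrite mxE.
  apply: le_trans (coord_le_weight _ l0) _; apply: weight_le lb _ => // i.
  by have /andP[] := bb.1 i.
move=> _ [[b lam] [[[lb1 lb2] [ab1 ab2]] [bb l0]] <-] /=; split=> //.
apply/dominated_setP; split; last exact/dominates1.
apply/production_setP; split; first exact: box_activity bb.
by exists lam; [move=> j; have /andP[] := l0 j; rewrite mxE|apply/dominates1].
Qed.

(** * Attained extrema *)

(** The maximum over the compact part of the dominated set in the box is a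
    global one, since each dominated activity has a better one in the box. *)
Lemma log_lipschitz_max F a c B : log_lipschitz F -> 0 < c -> box c B a ->
  exists b, [/\ dominated_set X Y a b, box (c / kappa) (B * kappa) b &
    forall b', dominated_set X Y a b' -> F b' <= F b].
Proof.
move=> FL c0 ab; have aA := box_activity c0 ab.
have c'0 : 0 < c / kappa by rewrite divr_gt0.
pose D := dominated_set X Y a `&` box (c / kappa) (B * kappa).
have DP b : D b -> P b by move=> [/dominated_setP[]].
have [||b] := @compact_EVT_max _ R F D _ (@compact_dominated a _ _ c'0).
- have [b0 /(dominated_set_box c0 ab)[b [db bb _]]] := dominated_set_nonempty aA.
  by exists b.
- apply: log_lipschitz_continuous => [b /DP[]//|b /DP|b [db bb]].
    exact: FL.1.
  have [N NP] := FL.2 _ (B * kappa) c'0; exists N => t b' /andP[t1 _] [db' bb'] h h'.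
  by split; apply: NP => //; exact: DP.
rewrite inE => -[db bb] bmax; exists b; split=> // b' db'.
have [b2 [db2 bb2 b2b']] := dominated_set_box c0 ab db'.
apply: le_trans (bmax b2 _); last by rewrite inE.
apply: log_lipschitz_antitone FL _ _ b2b'.
  by have /dominated_setP[] := db2.
by have /dominated_setP[] := db'.
Qed.

Lemma super_feasible_ratio (a t : io_pair) : activity a ->
  super_sbm_delta a t = ratio_quotient (a.1 + t.1, a.2 - t.2) a.
Proof.
move=> [a1 a2].
by rewrite /ratio_quotient /= !mean_ratioD mean_ratioN !mean_ratio_id.
Qed.

(** The substitution [b = (x + t^-, y - t^+)] identifies the feasible
    slacks [(t^-, t^+)] with the dominated activities [b]. *)
Lemma super_sbm_scoreP a c B : 0 < c -> box c B a ->
  exists b, [/\ dominated_set X Y a b,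
    super_sbm_score X Y a = ratio_quotient b a &
    forall b', dominated_set X Y a b' ->
      super_sbm_score X Y a <= ratio_quotient b' a].
Proof.
move=> c0 ab; have aA := box_activity c0 ab.
have [b [db _ bmax]] := log_lipschitz_max (ratio_quotient_log_lipschitz aA) c0 ab.
have pos b' : dominated_set X Y a b' -> 0 < ratio_quotient b' a.
  by move=> /dominated_setP[[b'A _] _]; exact: ratio_quotient_gt0.
have bmin b' : dominated_set X Y a b' -> ratio_quotient b a <= ratio_quotient b' a.
  by move=> db'; rewrite -lef_pV2 ?posrE ?pos// bmax.
suff E : super_sbm_score X Y a = ratio_quotient b a.
  by exists b; split=> // b' db'; rewrite E bmin.
apply: set_minE.
  have [[[b1 b2] [lam [l0 lb1 lb2]]] ab1 ab2] := db.
  have e1 : a.1 + (b.1 - a.1) = b.1 by rewrite addrC subrK.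
  have e2 : a.2 - (a.2 - b.2) = b.2 by rewrite opprB addrC subrK.
  exists (b.1 - a.1, a.2 - b.2); last first.
    by rewrite super_feasible_ratio//= e1 e2; case: (b).
  split=> /=.
  - by move=> i; have := ab1 i; rewrite !mxE subr_ge0.
  - by move=> i; have := ab2 i; rewrite !mxE subr_ge0.
  - by rewrite e2.
  - by exists lam; rewrite e1 e2.
move=> _ [t [t1 t2 t3 [lam [l0 h1 h2]]] <-]; rewrite super_feasible_ratio//.
apply: bmin; split=> /=.
- split; last by exists lam.
  split=> //= i; have := aA.1 i; have := t1 i; rewrite !mxE => ? ?.
  exact: ltr_wpDr.
- by move=> i; rewrite [leRHS]mxE lerDl; have := t1 i; rewrite mxE.
- by move=> i; rewrite [leLHS]mxE gerDl mxE oppr_le0; have := t2 i; rewrite mxE.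
Qed.

Lemma best_sbm_scoreP a c B : 0 < c -> box c B a ->
  exists b, [/\ dominated_set X Y a b, box (c / kappa) (B * kappa) b &
    set_max [set sbm_score X Y b' | b' in dominated_set X Y a] = sbm_score X Y b
    /\ forall b', dominated_set X Y a b' -> sbm_score X Y b' <= sbm_score X Y b].
Proof.
move=> c0 ab.
have [b [db bb bmax]] := log_lipschitz_max sbm_score_log_lipschitz c0 ab.
exists b; split=> //; split=> //; apply: set_maxE; first by exists b.
by move=> _ [b' db' <-]; exact: bmax.
Qed.

(** * Transfer of optima between neighbouring activities *)

Definition inflate (t : R) (b : io_pair) : io_pair := (t *: b.1, t^-1 *: b.2).

Lemma inflate_dominates t b : 0 < t -> dominates t (inflate t b) b.
Proof.
by move=> t0; split=> i //; rewrite scalerA divff ?scale1r// gt_eqF.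
Qed.

(** The factor [t] lost in passing from [a] to [a'] is made up for by [inflate],
    which stays in [P] because it only worsens activities. *)
Lemma inflate_dominated t (a a' b : io_pair) : 1 <= t -> dominates t a' a ->
  dominated_set X Y a b -> dominated_set X Y a' (inflate t b).
Proof.
move=> t1 [aa1 aa2] [[[b1 b2] [lam [l0 lb1 lb2]]] ab1 ab2].
have t0 : 0 < t by apply: lt_le_trans t1.
split=> [|i|i] /=.
- split.
    split=> i; rewrite !mxE.
      by rewrite mulr_gt0//; have := b1 i; rewrite mxE.
    by rewrite mulr_gt0 ?invr_gt0//; have := b2 i; rewrite mxE.
  exists lam; split=> // i; rewrite /inflate /=.
    apply: le_trans (lb1 i) _; rewrite mxE ler_peMl//.
    by have := b1 i; rewrite mxE => /ltW.
  apply: le_trans (lb2 i); rewrite mxE ler_piMl ?invf_le1//.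
  by have := b2 i; rewrite mxE => /ltW.
- by apply: le_trans (aa1 i) _; rewrite !mxE ler_pM2l.
- rewrite mxE ler_pdivrMl//; apply: le_trans (ab2 i) _.
  by have := aa2 i; rewrite mxE.
Qed.

Lemma inflate_box t b c B : 0 < c -> 1 <= t <= 2 -> box c B b ->
  box (c / 2) (B * 2) (inflate t b).
Proof.
move=> c0 /andP[t1 t2] bb; have cB := box_le bb.
have t0 : 0 < t by apply: lt_le_trans t1.
split=> i; rewrite mxE.
  by have /andP[h1 h2] := bb.1 i; apply/andP; split; nra.
have /andP[h1 h2] := bb.2 i; apply/andP; split.
  rewrite ler_pdivlMl//; nra.
rewrite ler_pdivrMl//; nra.
Qed.

(** The exponent is [4]: one factor [t] from inflating the optimum of [a] and
    one from replacing [a] by [a'] in the denominators, in both mean ratios. *)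
Lemma super_sbm_score_transfer t a a' c B : 0 < c -> 1 <= t ->
  box c B a -> box c B a' -> dominates t a a' -> dominates t a' a ->
  super_sbm_score X Y a' <= t ^+ 4 * super_sbm_score X Y a.
Proof.
move=> c0 t1 ab ab' aa' a'a.
have t0 : 0 < t by apply: lt_le_trans t1.
have [b [db -> _]] := super_sbm_scoreP c0 ab.
have db' := inflate_dominated t1 a'a db.
have [_ [_ _ /(_ _ db')]] := super_sbm_scoreP c0 ab'; move/le_trans; apply.
have -> : t ^+ 4 = (t * t) ^+ 2 by rewrite -expr2 -exprM.
apply: ratio_quotient_scale => //; rewrite ?(ltW t0)//.
- by case: db' => -[].
- by case: db => -[].
- exact: box_activity ab'.
- exact: box_activity ab.
- exact: inflate_dominates.
Qed.

Lemma best_sbm_score_transfer c B : 0 < c -> exists N, forall t a a',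
  1 <= t <= 2 -> box c B a -> box c B a' -> dominates t a a' ->
  set_max [set sbm_score X Y b | b in dominated_set X Y a'] <=
  t ^+ N * set_max [set sbm_score X Y b | b in dominated_set X Y a].
Proof.
move=> c0; have c'0 : 0 < c / kappa / 2 by rewrite !divr_gt0.
have [N NP] := sbm_score_log_lipschitz.2 _ (B * kappa * 2) c'0.
exists N => t a a' t12 ab ab' aa'; have /andP[t1 t2] := t12.
have t0 : 0 < t by apply: lt_le_trans t1.
have [b' [db' bb' [-> _]]] := best_sbm_scoreP c0 ab'.
have [b [_ _ [-> bmax]]] := best_sbm_scoreP c0 ab.
have db := inflate_dominated t1 aa' db'.
have ib := inflate_box (divr_gt0 c0 kappa0) t12 bb'.
apply: (@le_trans _ _ (t ^+ N * sbm_score X Y (inflate t b'))).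
  apply: NP => //; [by case: db|by case: db'| |exact: inflate_dominates].
  apply: box_sub bb'.
    by rewrite ler_pdivrMr// ler_peMr ?ler1n// ltW// divr_gt0.
  rewrite ler_peMr ?ler1n// mulr_ge0 ?(ltW kappa0)//.
  exact: le_trans (ltW c0) (box_le ab).
by rewrite ler_wpM2l ?exprn_ge0 ?(ltW t0)// bmax.
Qed.

Lemma composite_sbm_score_ge0 a : activity a -> 0 <= composite_sbm_score X Y a.
Proof.
move=> aA; have [[c B] /= [c0 ab]] := activity_box aA.
have [b [[[bA _] _ _] Eb _]] := super_sbm_scoreP c0 ab.
have [b' [[Pb' _ _] _ [Eb' _]]] := best_sbm_scoreP c0 ab.
rewrite /composite_sbm_score Eb Eb' mulr_ge0 ?sbm_score_log_lipschitz.1//.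
exact/ltW/ratio_quotient_gt0.
Qed.

Lemma composite_sbm_score_transfer c B : 0 < c -> exists N, forall t a a',
  1 <= t <= 2 -> box c B a -> box c B a' -> dominates t a a' ->
  dominates t a' a ->
  composite_sbm_score X Y a' <= t ^+ N * composite_sbm_score X Y a.
Proof.
move=> c0; have [N NP] := best_sbm_score_transfer B c0.
exists (4 + N)%N => t a a' t12 ab ab' aa' a'a; have /andP[t1 t2] := t12.
have [b [[[bA _] _ _] Eb _]] := super_sbm_scoreP c0 ab'.
have [b' [[Pb' _ _] _ [Eb' _]]] := best_sbm_scoreP c0 ab'.
rewrite exprD /composite_sbm_score mulrACA ler_pM//.
- by rewrite Eb; apply/ltW/ratio_quotient_gt0 => //; exact: box_activity ab'.
- by rewrite Eb' sbm_score_log_lipschitz.1.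
- exact: super_sbm_score_transfer ab ab' aa' a'a.
- exact: NP.
Qed.

Lemma composite_sbm_score_continuous :
  {within (activity : set io_pair), continuous (composite_sbm_score X Y)}.
Proof.
apply: log_lipschitz_continuous => // [a|a aA].
  exact: composite_sbm_score_ge0.
have [[c B] /= [c0 ab]] := activity_box aA.
have c20 : 0 < c / 2 by rewrite divr_gt0.
have cB := box_le ab.
have [N NP] := composite_sbm_score_transfer (B * 2) c20.
have ab2 : box (c / 2) (B * 2) a by apply: box_sub ab; lra.
exists N => t a' t12 a'A aa' a'a; have /andP[t1 t2] := t12.
have ab' : box (c / 2) (B * 2) a'.
  split=> i.
    have /andP[h1 h2] := ab.1 i; have := aa'.1 i; have := a'a.1 i.
    have := a'A.1 i; rewrite !mxE => h3 h4 h5; apply/andP; split; nra.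
  have /andP[h1 h2] := ab.2 i; have := aa'.2 i; have := a'a.2 i.
  have := a'A.2 i; rewrite !mxE => h3 h4 h5; apply/andP; split; nra.
by split; apply: NP.
Qed.

End Technology.

Theorem proposition5p2 (R : realType) (m s n : nat)
  (hm : (1 <= m)%N) (hs : (1 <= s)%N) (hn : (1 <= n)%N)
  (X : 'M[R]_(m, n)) (Y : 'M[R]_(s, n))
  (hXY : forall j : 'I_n, activity (col j X, col j Y)) :
  {within (activity : set ('cV[R]_m * 'cV[R]_s)),
    continuous (composite_sbm_score X Y)}.
Proof.
(* The least and greatest entries of the data; the default value 1 is harmless
   because it is positive. *)
have hX i j : 0 < X i j by have := (hXY j).1 i; rewrite !mxE.
have hY r j : 0 < Y r j by have := (hXY j).2 r; rewrite !mxE.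
pose lo := Num.min (\big[Num.min/1]_p X p.1 p.2) (\big[Num.min/1]_p Y p.1 p.2).
pose hi := Num.max (\big[Num.max/1]_p X p.1 p.2) (\big[Num.max/1]_p Y p.1 p.2).
have lo0 : 0 < lo by rewrite lt_min !lt_bigmin.
have Xb i j : lo <= X i j <= hi.
  rewrite ge_min le_max (bigmin_le 1 (i, j) (fun p => X p.1 p.2)).
  by rewrite (le_bigmax 1 (fun p => X p.1 p.2) (i, j)).
have Yb i j : lo <= Y i j <= hi.
  rewrite ge_min le_max (bigmin_le 1 (i, j) (fun p => Y p.1 p.2)) orbT.
  by rewrite (le_bigmax 1 (fun p => Y p.1 p.2) (i, j)) orbT.
have lohi : lo <= hi.
  by have /andP[h1 h2] := Xb (Ordinal hm) (Ordinal hn); exact: le_trans h2.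
exact: (composite_sbm_score_continuous hm hs hn lo0 lohi Xb Yb).
Qed.
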